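(* Assume that $(\mu,\rho,V,\mathcal L)$ satisfies the relative admissibility condition and that $(V,\mathcal L)$ is a nonnegative pair. Then there is a quadrature rule with at most $N$ nodes in $D$ and positive weights that is exact on $V$; that is, there are an integer $\widetilde M\le N$, points $x_1,\dots,x_{\widetilde M}\in D$ and weights $w_1,\dots,w_{\widetilde M}>0$ with $\sum_{m=1}^{\widetilde M}w_mv(x_m)=\mathcal L(v)$ for all $v\in V$.
   Context: Setting. $\mu$ is a positive measure with closed support $D$ in a Banach space; functions on $D$ are $\mu$-measurable, complex-valued and pointwise defined. $\langle u,v\rangle=\int_D\overline{u}\,v\,d\mu$ and $\|\cdot\|$ are the inner product and norm of $L^2_\mu(D)$. $V\subset L^2_\mu(D)$ is a subspace of finite complex dimension $N\geq 1$; an $L^2_\mu$-orthonormal basis of $V$ is fixed, with fixed measurable pointwise representatives $\varphi_1,\dots,\varphi_N$, and $V$ is identified with the space of pointwise-defined functions $\sum_n c_n\varphi_n$. Write $k(x)=\sum_{n=1}^N|\varphi_n(x)|^2$. Sampling measure. $\tau^2:D\to[0,\infty)$ is measurable with $\int_D\tau^2\,d\mu=1$ and satisfies the coverage condition: $k(x)=0$ for $\mu$-almost every $x\in\{\tau^2=0\}$. $\rho$ is the probability measure $d\rho=\tau^2\,d\mu$, and $Q=\operatorname{ess\,sup}_{x\sim\rho}k(x)/\tau^2(x)$. Ratios of nonnegative quantities use the conventions $0/0=0$ and $a/0=+\infty$ for $a>0$. Functional. $\mathcal L\in V^*$ is a nonzero linear functional, $L\in V$ is its Riesz representer ($\mathcal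 L(v)=\langle L,v\rangle$ for $v\in V$), and $\|\mathcal L\|_{V^*}=\|L\|$. Relative admissibility. Let $\cos\gamma(x)=\frac{|L(x)|}{\|\mathcal L\|_{V^*}\sqrt{k(x)}}$ if $k(x)>0$ and $\cos\gamma(x)=1$ if $k(x)=0$. Let $p_J=\Pr_{X\sim\rho}[1/\cos\gamma(X)\ge J^{1/2}]$. The tuple $(\mu,\rho,V,\mathcal L)$ is relatively admissible if $Q<\infty$ and $\lim_{J\to\infty}Jp_J=0$. Nonnegative pair. $V$ is closed under complex conjugation if $v\in V\Rightarrow\overline v\in V$; $V_{\mathbb R}=\{v\in V:v=\overline v\}$. $\mathcal L$ is real-preserving if $\mathcal L(v)\in\mathbb R$ for every $v\in V_{\mathbb R}$. $(V,\mathcal L)$ is a nonnegative pair if $V$ is closed under complex conjugation, $\mathcal L$ is real-preserving, and the Riesz representer $L$ admits a pointwise representative with $L(x)\ge0$ for all $x\in D$. *)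

(* Defs.v *)
From HB Require Import structures.
From mathcomp Require Import all_boot all_order all_algebra.
From mathcomp Require Import all_classical all_reals all_analysis.
From mathcomp Require Import ess_sup_inf complex.

Set Implicit Arguments.
Unset Strict Implicit.
Unset Printing Implicit Defensive.

Import Order.TTheory GRing.Theory Num.Theory.
Import numFieldNormedType.Exports.

Local Open Scope classical_set_scope.
Local Open Scope ring_scope.
Local Open Scope complex_scope.

(* R-valued modulus; the library's `|z| is R[i]-valued. *)
Notation cmod := ComplexField.Normc.normc.

(* <<s G>> is meant to contain the open sets; it need not be the Borel
   sigma-algebra, so that completions are covered. *)
Definition is_closed_support (R : realType) (X : completeNormedModType R)
    (G : set (set X)) (mu : {measure set (g_sigma_algebraType G) -> \bar R})
    (D : set X) : Prop :=
  [/\ closed D,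
      mu (~` D) = 0%E &
      forall F : set X, closed F -> mu (~` F) = 0%E -> D `<=` F].

Section L2.
Context (d : measure_display) (T : measurableType d) (R : realType).
Variables (mu : {measure set T -> \bar R}) (D : set T).
Implicit Types u v : T -> R[i].

(* A function on D is a function on T whose values outside D are irrelevant. *)
Definition cmeasurable u : Prop :=
  measurable_fun D (fun x => complex.Re (u x)) /\ measurable_fun D (fun x => complex.Im (u x)).

Definition square_integrable u : Prop :=
  cmeasurable u /\ (\int[mu]_(x in D) (cmod (u x) ^+ 2)%:E < +oo)%E.

Definition cintegral u : R[i] :=
  Complex (\int[mu]_(x in D) complex.Re (u x)) (\int[mu]_(x in D) complex.Im (u x)).

Definition inner u v : R[i] := cintegral (fun x => conjc (u x) * v x).

Definition L2norm u : R := Num.sqrt (\int[mu]_(x in D) (cmod (u x) ^+ 2)).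

Definition ae_eq_on u v : Prop := \forall x \ae mu, D x -> u x = v x.

Definition orthonormal_family (N : nat) (phi : 'I_N -> T -> R[i]) : Prop :=
  (forall n, square_integrable (phi n)) /\
  (forall m n, inner (phi m) (phi n) = (m == n)%:R).

Definition span_of (N : nat) (phi : 'I_N -> T -> R[i]) : set (T -> R[i]) :=
  [set v | exists c : 'I_N -> R[i], v = fun x => \sum_(n < N) c n * phi n x].

Definition kfun (N : nat) (phi : 'I_N -> T -> R[i]) (x : T) : R :=
  \sum_(n < N) cmod (phi n x) ^+ 2.

Definition linear_on (V : set (T -> R[i])) (ell : (T -> R[i]) -> R[i]) : Prop :=
  forall (a : R[i]) u v, V u -> V v ->
    ell (fun x => a * u x + v x) = a * ell u + ell v.

Definition dual_norm (V : set (T -> R[i])) (ell : (T -> R[i]) -> R[i]) : R :=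
  sup [set cmod (ell v) | v in [set v | V v /\ L2norm v <= 1]].

Definition riesz_representer (V : set (T -> R[i]))
    (ell : (T -> R[i]) -> R[i]) (L : T -> R[i]) : Prop :=
  V L /\ forall v, V v -> ell v = inner L v.

Definition sampling_measure (N : nat) (phi : 'I_N -> T -> R[i])
    (tau2 : T -> R) (rho : probability T R) : Prop :=
  [/\ measurable_fun D tau2,
      forall x, D x -> 0 <= tau2 x,
      (\int[mu]_(x in D) (tau2 x)%:E = 1)%E,
      \forall x \ae mu, D x -> tau2 x = 0 -> kfun phi x = 0 &
      forall A, measurable A ->
        (rho A = \int[mu]_(x in D `&` A) (tau2 x)%:E)%E].

(* In \bar R, 0^-1 = +oo and 0 * +oo = 0, so 0 / 0 = 0 and a / 0 = +oo
   for a > 0. *)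
Definition Qsup (N : nat) (phi : 'I_N -> T -> R[i]) (tau2 : T -> R)
    (rho : probability T R) : \bar R :=
  ess_sup rho (fun x => (kfun phi x)%:E / (tau2 x)%:E)%E.

Definition cos_gamma (N : nat) (phi : 'I_N -> T -> R[i])
    (ell : (T -> R[i]) -> R[i]) (L : T -> R[i]) (x : T) : R :=
  if 0 < kfun phi x then
    cmod (L x) / (dual_norm (span_of phi) ell * Num.sqrt (kfun phi x))
  else 1.

Definition tail_prob (N : nat) (phi : 'I_N -> T -> R[i])
    (ell : (T -> R[i]) -> R[i]) (L : T -> R[i])
    (rho : probability T R) (J : nat) : \bar R :=
  rho [set x | D x /\
    ((Num.sqrt J%:R)%:E <= 1 / (cos_gamma phi ell L x)%:E)%E].

Definition relatively_admissible (N : nat) (phi : 'I_N -> T -> R[i])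
    (tau2 : T -> R) (rho : probability T R)
    (ell : (T -> R[i]) -> R[i]) (L : T -> R[i]) : Prop :=
  (Qsup phi tau2 rho < +oo)%E /\
  (fun J : nat => (J%:R)%:E * tail_prob phi ell L rho J)%E @ \oo --> 0%E.

(* V is a subspace of L^2, so conjc v \in V and v = conjc v are understood mu-almost
   everywhere on D. *)
Definition conj_closed (V : set (T -> R[i])) : Prop :=
  forall v, V v -> exists2 w, V w & ae_eq_on w (fun x => conjc (v x)).

Definition real_part_space (V : set (T -> R[i])) : set (T -> R[i]) :=
  [set v | V v /\ ae_eq_on v (fun x => conjc (v x))].

Definition real_preserving (V : set (T -> R[i]))
    (ell : (T -> R[i]) -> R[i]) : Prop :=
  forall v, real_part_space V v -> ell v \is Num.real.

(* 0 <= z in R[i] means that z is real and nonnegative. *)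
Definition nonnegative_pair (V : set (T -> R[i]))
    (ell : (T -> R[i]) -> R[i]) (L : T -> R[i]) : Prop :=
  [/\ conj_closed V,
      real_preserving V ell &
      exists L' : T -> R[i],
        [/\ cmeasurable L', ae_eq_on L' L & forall x, D x -> 0 <= L' x]].

End L2.

(* Main.v *)
Require Import Defs.
From HB Require Import structures.
From mathcomp Require Import all_boot all_order all_algebra.
From mathcomp Require Import all_classical all_reals all_analysis.
From mathcomp Require Import ess_sup_inf complex.
From mathcomp Require Import finmap measurable_realfun ring lra.

Import Order.TTheory GRing.Theory Num.Theory.
Import numFieldNormedType.Exports.

Local Open Scope classical_set_scope.
Local Open Scope ring_scope.
Local Open Scope complex_scope.

(** Since L is nonnegative almost everywhere, ell v = <L, v> is the integral of
    v against the positive measure L dmu, and every v in V is integrable for it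
    because L and v are both square integrable. So the theorem is an instance
    of Tchakaloff's theorem: the integral of a vector-valued function against a
    positive measure is a conic combination of finitely many of its values.
    The cone generated by the values need not be closed, so only a weak
    separation is available outside it.

    The vectors are the real coordinates (Re phi_1(x), .., Re phi_N(x),
    Im phi_1(x), .., Im phi_N(x)), and p is their integral. If p is outside the
    cone generated by the values on a set of full measure, a nonzero linear form
    l is nonnegative on the cone and nonpositive at p (conic_hull_separation,
    by Farkas' lemma and compactness of the unit sphere). The integral of the
    nonnegative function l(f(x)) is l(p), hence it vanishes, and almost every
    value lies in the hyperplane l = 0, as p does. An induction on the dimension
    concludes (strictly_positive_mean_conic_hull).

    It remains to get N nodes where the coordinates live in dimension 2N. As V
    is closed under conjugation, conj phi = C phi almost everywhere for some
    matrix C, so almost all values lie in the real subspace of the z in C^N with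
    conj z = C z, which meets its multiple by the imaginary unit only in 0, and
    so has real dimension at most N (dim_real_form). Caratheodory's theorem for
    cones brings the number of nodes down to that dimension. *)

(** * Linear algebra of finite cones *)

(** By induction on the number of generators. If the form l found for the last k
    of them is negative at the first one, a, then projecting along a onto the
    kernel of l leaves k generators; a certificate for the projections lifts in
    either case, the coefficient of a being nonnegative by the signs of l. *)
Lemma farkas_alternative {R : realFieldType} {k n : nat} (A : 'M[R]_(k, n)) (p : 'rV_n) :
  (exists2 w : 'rV_k, forall i, 0 <= w 0 i & p = w *m A) \/
  (exists2 l : 'cV_n, forall i, 0 <= (A *m l) i 0 & (p *m l) 0 0 < 0).
Proof.
elim: k A p => [|k IHk] A p.
  have [->|p_neq0] := eqVneq p 0.
    by left; exists 0 => [[]//|]; rewrite mul0mx.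
  right; exists (- p^T) => [[]//|].
  rewrite mulmxN !mxE oppr_lt0.
  have /rV0Pn[j pj_neq0] := p_neq0.
  rewrite (bigD1 j)//= ltr_pwDl//.
    by rewrite mxE -expr2 exprn_even_gt0.
  by apply: sumr_ge0 => i _; rewrite mxE -expr2 sqr_ge0.
move: A; rewrite -(add1n k) => A; rewrite -[A]vsubmxK.
set a := usubmx A; set A' := dsubmx A.
have [[w w_ge0 pE]|[l Al_ge0 pl_lt0]] := IHk A' p.
  left; exists (row_mx 0 w) => [i|].
    by rewrite mxE; case: fintype.split => j //; rewrite mxE.
  by rewrite mul_row_col mul0mx add0r.
have [al_ge0|al_lt0] := leP 0 ((a *m l) 0 0).
  right; exists l => // i; rewrite mul_col_mx mxE.
  by case: fintype.split => j //; rewrite (ord1 j).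
pose c := (a *m l) 0 0.
have alE : a *m l = c%:M by rewrite [LHS]mx11_scalar.
pose P : 'M[R]_n := 1%:M - c^-1 *: (l *m a).
have aP0 : a *m P = 0.
  rewrite mulmxBr mulmx1 -scalemxAr mulmxA alE mul_scalar_mx scalerA.
  by rewrite mulVf ?scale1r ?subrr// lt_eqF.
have [[w w_ge0 pPE]|[m Am_ge0 pm_lt0]] := IHk (A' *m P) (p *m P).
  left; exists (row_mx (c^-1 *: (p *m l - w *m A' *m l)) w) => [i|].
    rewrite mxE; case: fintype.split => j //; rewrite (ord1 j) mxE.
    rewrite nmulr_rge0 ?invr_lt0// mxE [X in _ + X]mxE subr_le0.
    apply: (le_trans (ltW pl_lt0)); rewrite -mulmxA mxE.
    by apply: sumr_ge0 => i' _; rewrite mulr_ge0.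
  rewrite mul_row_col -scalemxAl mulmxBl -!mulmxA.
  move: pPE; rewrite mulmxA !mulmxBr !mulmx1 -!scalemxAr => /eqP.
  rewrite subr_eq => /eqP {1}->.
  by rewrite scalerBr -!mulmxA addrAC -addrA addrC.
right; exists (P *m m) => [i|]; last by rewrite mulmxA.
rewrite mulmxA mul_col_mx aP0 mul_col_mx mul0mx mxE.
by case: fintype.split => j //; rewrite mxE.
Qed.

(** Rows that carry positive weights and outnumber the rank satisfy a linear
    relation; subtracting the largest multiple of it that keeps the weights
    nonnegative cancels one of them. *)
Lemma caratheodory_conic {R : realFieldType} {M n : nat} (F : 'M[R]_(M, n))
    {w : 'rV_M} (w_ge0 : forall i, 0 <= w 0 i) :
  exists w' : 'rV_M, [/\ forall i, 0 <= w' 0 i, w' *m F = w *m F &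
    (#|[set i | w' 0%R i != 0%R]%SET| <= \rank F)%N].
Proof.
have [k] := ubnP #|[set i | w 0%R i != 0%R]%SET|.
elim: k w w_ge0 => // k IHk w w_ge0; rewrite ltnS => wk.
set S := finset _ in wk *.
have [Sr|rS] := leqP #|S| (\rank F); first by exists w.
pose g (i : 'I_#|S|) : 'I_M := enum_val i.
have : kermx (rowsub g F) != 0.
  rewrite kermx_eq0 /row_free neq_ltn.
  rewrite (leq_ltn_trans _ rS)//.
  by rewrite rowsubE mxrankM_maxr.
move=> /rowV0Pn[c /sub_kermxP cF c_neq0].
pose d0 := c *m rowsub g 1%:M.
have d0F : d0 *m F = 0 by rewrite -mulmxA -rowsubE.
have d0E j : d0 0 (g j) = c 0 j.
  rewrite mxE (bigD1 j)//= big1 => [|i ij].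
    by rewrite !mxE eqxx mulr1 addr0.
  by rewrite !mxE (inj_eq enum_val_inj) (negPf ij) mulr0.
have d0S i : i \notin S -> d0 0 i = 0.
  move=> iS; rewrite mxE big1// => j _; rewrite !mxE.
  case: eqP => [gji|_]; last by rewrite mulr0.
  by move: iS; rewrite -gji enum_valP.
(* The relation d0 or its opposite has a positive entry, which bounds the
   multiple that can be subtracted. *)
have [d [i0 di0] [dF dS]] : exists2 d : 'rV_M, (exists i, 0 < d 0 i) &
    d *m F = 0 /\ forall i, i \notin S -> d 0 i = 0.
  have /rV0Pn[j cj] := c_neq0.
  have [d0_gt0|d0_le0] := ltP 0 (d0 0 (g j)).
    by exists d0 => //; exists (g j).
  exists (- d0); last first.
    split; first by rewrite mulNmx d0F oppr0.
    by move=> i iS; rewrite mxE d0S// oppr0.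
  by exists (g j); rewrite mxE oppr_gt0 lt_neqAle d0_le0 d0E cj.
case: (@arg_minP _ _ _ i0 (fun i => 0 < d 0 i) (fun i => w 0 i / d 0 i) di0).
move=> j dj jmin; set t := w 0 j / d 0 j in jmin.
have t_ge0 : 0 <= t by rewrite divr_ge0// ltW.
have jS : j \in S.
  by apply: contraLR dj => /dS ->; rewrite ltxx.
have [||w' [w'_ge0 w'F w'r]] := IHk (w - t *: d).
- move=> i; rewrite !mxE subr_ge0.
  have [di|di] := ltP 0 (d 0 i); first by rewrite -ler_pdivlMr// jmin.
  by rewrite (le_trans _ (w_ge0 i))// mulr_ge0_le0.
- apply: leq_trans wk; apply: proper_card; apply/fintype.properP; split.
    apply/fintype.subsetP => i; rewrite inE; apply: contraR => iS.
    have := iS; rewrite inE negbK => /eqP wi.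
    by rewrite !mxE wi dS// mulr0 subr0.
  by exists j => //; rewrite inE negbK !mxE /t mulfVK ?subrr// gt_eqF.
exists w'; split => //.
by rewrite w'F mulmxBl -scalemxAl dF scaler0 subr0.
Qed.

(** The kernel consists of the coordinates (a, b) of the z = a + ib with
    conj z = z (A + iB). Multiplication by i is given by J, and it maps the
    kernel to a subspace that meets it only in 0. In terms of ranks: J K - K J
    is invertible, so 2 N <= 2 rank K. *)
Lemma dim_real_form {R : numFieldType} {N : nat} (A B : 'M[R]_N) :
  (\rank (kermx (block_mx (A - 1%:M) B (- B) (A + 1%:M))) <= N)%N.
Proof.
set K := block_mx _ _ _ _.
pose J : 'M[R]_(N + N) := block_mx 0 1%:M (- 1%:M) 0.
pose sw : 'M[R]_(N + N) := block_mx 0 1%:M 1%:M 0.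
have JKE : J *m K - K *m J = 2%:R *: sw.
  rewrite /J /K /sw !mulmx_block !mul0mx !mulmx0 !mul1mx !mulmx1 !mulNmx !mulmxN.
  rewrite !mul1mx !mulmx1 !add0r !addr0 opp_block_mx add_block_mx scale_block_mx.
  rewrite scaler0 scaler_nat mulr2n; congr block_mx;
    apply/matrixP => i j; rewrite !mxE; ring.
have swsw : sw *m sw = 1%:M.
  by rewrite mulmx_block !mul0mx !mulmx0 !mul1mx !add0r !addr0 -scalar_mx_block.
have ranksw : \rank (2%:R *: sw) = (N + N)%N.
  rewrite mxrank_scale_nz ?pnatr_eq0//; apply/eqP.
  by apply/row_freeP; exists sw.
have NK : (N <= \rank K)%N.
  have := mxrank_add (J *m K) (- (K *m J)).
  rewrite JKE ranksw mxrank_opp => le2N.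
  have := leq_trans le2N (leq_add (mxrankM_maxr _ _) (mxrankM_maxl _ _)).
  by rewrite [X in (_ <= X)%N]addnn [X in (X <= _)%N]addnn leq_double.
by rewrite mxrank_ker leq_subLR leq_add2r.
Qed.

(** * Separation from a cone that need not be closed *)

Definition conic_hull {R : realType} {T : Type} {n : nat} (f : T -> 'rV[R]_n)
    (A : set T) : set 'rV[R]_n :=
  [set p | exists (M : nat) (x : 'I_M -> T) (w : 'rV[R]_M),
    [/\ forall i, A (x i), forall i, 0 <= w 0 i & p = w *m \matrix_i f (x i)]].

Lemma continuous_mulmx_coord {R : realType} {n : nat} (p : 'rV[R]_n) :
  continuous (fun l : 'rV[R]_n => (p *m l^T) 0 0).
Proof.
rewrite (_ : (fun l => _) = (fun l : 'rV_n => \sum_j p 0 j * l 0 j)); last first.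
  by apply/funext => l; rewrite mxE; apply: eq_bigr => j _; rewrite mxE.
move=> l; apply: (cvg_big add_continuous (F := nbhs l)) => j _.
by apply: cvgM; [exact: cvg_cst|exact: coord_continuous].
Qed.

(** The separation is weak, as it must be when p lies on the boundary of a
    cone that does not contain it; what matters is that l is nonzero. *)
Lemma conic_hull_separation {R : realType} {T : choiceType} {n : nat}
    (f : T -> 'rV[R]_n) (A : set T) (p : 'rV_n) :
  ~ conic_hull f A p ->
  exists l : 'cV_n, [/\ l != 0, forall x, A x -> 0 <= (f x *m l) 0 0 &
    (p *m l) 0 0 <= 0].
Proof.
move=> pNf.
pose S := [set l : 'rV[R]_n | `|l| = 1].
have compactS : compact S.
  apply: bounded_closed_compact.
    by exists 1; split => // r r1 l /= ->; rewrite ltW.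
  have /continuous_closedP := @norm_continuous R 'rV[R]_n.
  by move=> c; exact: c (closed_eq (y:=1)).
(* The constraints on a unit vector l are closed, and by Farkas' lemma any
   finitely many of them are compatible. The constraint at p has index None, so
   that the family is nonempty, and l is in the sphere, even if A is empty. *)
pose h (o : option T) := [set l : 'rV[R]_n |
  if o is Some x then 0 <= (f x *m l^T) 0 0 else (p *m l^T) 0 0 <= 0].
have h_closed o : closed (h o).
  case: o => [x|].
    have /continuous_closedP := continuous_mulmx_coord (f x).
    by move=> c; exact: c (@closed_ge _ _).
  have /continuous_closedP := continuous_mulmx_coord p.
  by move=> c; exact: c (@closed_le _ _).
move: (compactS); rewrite compact_In0.
move=> /(_ _ [set o | if o is Some x then A x else True]).
move=> /(_ (fun o => S `&` h o)) [].
- by exists h => // o _; exact: h_closed.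
- move=> E EA; pose t := in_tuple (pmap id (enum_fset E)).
  have tE x : (x \in t) = (Some x \in E) by rewrite mem_pmap map_id.
  have [[w w_ge0 pE]|[l tl_ge0 pl_lt0]] := farkas_alternative (\matrix_i f (tnth t i)) p.
    exfalso; apply: pNf; exists _, (tnth t), w; split => // i.
    have : Some (tnth t i) \in E by rewrite -tE mem_tnth.
    by move=> /EA/set_mem.
  have l_neq0 : l^T != 0.
    by apply: contraTneq pl_lt0 => /(canRL (@trmxK _ _ _)) ->;
      rewrite trmx0 mulmx0 mxE ltxx.
  have l_gt0 : 0 < `|l^T| by rewrite normr_gt0.
  exists (`|l^T|^-1 *: l^T) => o oE; split.
    by rewrite /S/= normrZ normfV normr_id mulVf ?gt_eqF.
  rewrite /h/= linearZ/= trmxK; case: o oE => [x|_].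
    rewrite /= -tE => /tnthP[i ->].
    rewrite -scalemxAr mxE mulr_ge0 ?invr_ge0//.
    have := tl_ge0 i; congr (0 <= _).
    by rewrite !mxE; apply: eq_bigr => j _; rewrite mxE.
  by rewrite -scalemxAr mxE mulr_ge0_le0 ?invr_ge0// ltW.
- move=> l Sgl; have [lS pl] := Sgl None I.
  exists l^T; split => //.
    apply: contraTneq (oner_neq0 R) => lT0; rewrite negbK -lS.
    by rewrite -[l]trmxK lT0 trmx0 normr0.
  by move=> x Ax; have [] := Sgl (Some x) Ax.
Qed.

(** * Positive means lie in the cone *)

(** Tchakaloff's theorem, with F the filter of sets of full measure. The linear
    forms l see p as the mean of f: it is nonnegative if l is nonnegative along
    F, and zero only if l vanishes along F. If p were outside the cone, the
    separating form would vanish at p, hence along F, which brings the problem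
    to the kernel of l, of smaller dimension. When F contains the empty set, the
    hypothesis forces p = 0, the empty combination. *)
Lemma strictly_positive_mean_conic_hull {R : realType} {T : choiceType}
    {n : nat} (F : set_system T) {FF : Filter F} (f : T -> 'rV[R]_n) (p : 'rV_n) :
  (forall l : 'cV_n, (\forall x \near F, 0 <= (f x *m l) 0 0) ->
    0 <= (p *m l) 0 0 /\
    ((p *m l) 0 0 = 0 -> \forall x \near F, (f x *m l) 0 0 = 0)) ->
  forall A, F A -> conic_hull f A p.
Proof.
have [k] := ubnP n; elim: k n f p => // k IHk n f p; rewrite ltnS => nk fp A FA.
apply: contrapT => /[dup] pA /conic_hull_separation[l [l_neq0 Al pl_le0]].
have [|pl_ge0 pl0] := fp l; first exact: filterS FA.
have {pl_ge0 pl_le0} pl : (p *m l) 0 0 = 0 by apply/eqP; rewrite eq_le pl_le0.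
have {}pl0 := pl0 pl.
apply: pA; pose B := row_base (kermx l).
have BK (q : 'rV_n) : (q *m l) 0 0 = 0 -> q *m pinvmx B *m B = q.
  move=> ql; rewrite mulmxKpV// eq_row_base; apply/sub_kermxP.
  by rewrite [LHS]mx11_scalar ql raddf0.
have Bk : (\rank (kermx l) < k)%N.
  rewrite mxrank_ker; apply: leq_trans nk.
  have l_gt0 : (0 < \rank l)%N by rewrite lt0n mxrank_eq0.
  by rewrite ltn_subrL l_gt0 (leq_trans l_gt0 (rank_leq_row l)).
have [|M [x [w [xA w_ge0 pE]]]] := IHk _ (fun x => f x *m pinvmx B)
    (p *m pinvmx B) Bk _ (A `&` [set x | (f x *m l) 0 0 = 0]) (filterI FA pl0).
  move=> m fm; rewrite -mulmxA; have [|pm pm0] := fp (pinvmx B *m m).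
    by apply: filterS fm => x; rewrite -mulmxA.
  by split => // /pm0; apply: filterS => x; rewrite -[in X in _ -> X]mulmxA.
exists M, x, w; split => // [i|]; first by have [] := xA i.
rewrite -[LHS]BK// pE -mulmxA; congr (_ *m _).
by apply/row_matrixP => i; rewrite row_mul !rowK BK//; have [] := xA i.
Qed.

Section weighted_integrals.
Context {d : measure_display} {T : measurableType d} {R : realType}.
Variables (mu : {measure set T -> \bar R}) (D : set T).
Hypothesis mD : measurable D.

Lemma Rintegral_ae_ge0 (u : T -> R) : mu.-integrable D (EFin \o u) ->
  (\forall x \ae mu, D x -> 0 <= u x) ->
  0 <= \int[mu]_(x in D) u x /\
  (\int[mu]_(x in D) u x = 0 -> \forall x \ae mu, D x -> u x = 0).
Proof.
move=> iu u_ge0.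
have mu_u : measurable_fun D u.
  by have /integrableP[/measurable_EFinP] := iu.
have uE : (\int[mu]_(x in D) (u x)%:E = \int[mu]_(x in D) `|(u x)%:E|)%E.
  apply: ae_eq_integral => //; first exact/measurable_EFinP.
    exact/measurable_EFinP/measurableT_comp.
  by apply: filterS u_ge0 => x u_ge0 Dx; rewrite /= ger0_norm// u_ge0.
split.
  by rewrite /Rintegral uE fine_ge0// integral_ge0.
move=> u0; have : (\int[mu]_(x in D) `|(u x)%:E| = 0)%E.
  rewrite -uE -[LHS]fineK; last exact: integrable_fin_num.
  by congr EFin.
have /measurable_EFinP mEu := mu_u.
move=> /(ae_eq_integral_abs mu mD mEu).1.
by apply: filterS => x xu Dx; have [] := xu Dx.
Qed.

Lemma Rintegral_mulmx (n : nat) (g : T -> 'rV[R]_n) (l : 'cV_n) :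
  (forall j, mu.-integrable D (fun x => (g x 0 j)%:E)) ->
  mu.-integrable D (fun x => ((g x *m l) 0 0)%:E) /\
  \int[mu]_(x in D) (g x *m l) 0 0 = ((\row_j \int[mu]_(x in D) g x 0 j) *m l) 0 0.
Proof.
move=> ig.
have glE : (fun x => ((g x *m l) 0 0)%:E) =
    (fun x => \sum_j (l j 0)%:E * (g x 0 j)%:E)%E.
  apply/funext => x; rewrite mxE sumEFin; congr EFin.
  by apply: eq_bigr => j _; rewrite mulrC.
split; first by rewrite glE; apply: integrable_sum => // j _; exact: integrableZl.
rewrite /Rintegral glE integral_sum// => [|j]; last exact: integrableZl.
under eq_bigr do rewrite integralZl//.
rewrite -sum_fine => [|j _]; last by rewrite fin_numM// integrable_fin_num.
rewrite mxE; apply: eq_bigr => j _; rewrite fineM ?integrable_fin_num// mulrC.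
by rewrite mxE.
Qed.

(** The strictly positive mean here is integration against h dmu, whose sets of
    full measure are described by the almost-everywhere filter of mu within the
    set where h is nonzero. *)
Lemma Rintegral_in_conic_hull (n : nat) (f : T -> 'rV[R]_n) (h : T -> R) (A : set T) :
  (\forall x \ae mu, D x -> 0 <= h x) ->
  (forall j, mu.-integrable D (fun x => (h x * f x 0 j)%:E)) ->
  (\forall x \ae mu, D x -> A x) ->
  conic_hull f (D `&` A) (\row_j \int[mu]_(x in D) (h x * f x 0 j)).
Proof.
move=> h_ge0 ihf aeA.
pose F := within [set x | D x /\ h x != 0] (almost_everywhere mu).
apply: (strictly_positive_mean_conic_hull F) => [l fl_ge0|]; last first.
  by apply: filterS aeA => x DA [Dx _]; split => //; exact: DA.
have ihf' j : mu.-integrable D (fun x => ((h x *: f x) 0 j)%:E).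
  by rewrite (_ : (fun _ => _) = (fun x => (h x * f x 0 j)%:E))//;
    apply/funext => x; rewrite mxE.
have [ihfl hflE] := Rintegral_mulmx _ (fun x => h x *: f x) l ihf'.
have -> : \row_j \int[mu]_(x in D) (h x * f x 0 j) =
    \row_j \int[mu]_(x in D) (h x *: f x) 0 j.
  by apply/rowP => j; rewrite !mxE; apply: eq_Rintegral => x _; rewrite mxE.
rewrite -hflE.
have [||hfl_ge0 hfl0] := Rintegral_ae_ge0 (fun x => (h x *: f x *m l) 0 0).
- exact: ihfl.
- have : \forall x \ae mu, D x /\ h x != 0 -> 0 <= (f x *m l) 0 0 by exact: fl_ge0.
  apply: filterS2 h_ge0 => x hx flx Dx.
  rewrite -scalemxAl mxE; have [->|hx0] := eqVneq (h x) 0; first by rewrite mul0r.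
  by rewrite mulr_ge0 ?hx ?flx.
split => // /hfl0; apply: filterS => x fl0 [Dx hx].
by have /eqP := fl0 Dx; rewrite -scalemxAl mxE mulf_eq0 (negPf hx) => /eqP.
Qed.

(** Because |ab| <= a^2 + b^2. *)
Lemma integrable_mul (a b : T -> R) :
  measurable_fun D a -> measurable_fun D b ->
  (\int[mu]_(x in D) (a x ^+ 2)%:E < +oo)%E ->
  (\int[mu]_(x in D) (b x ^+ 2)%:E < +oo)%E ->
  mu.-integrable D (fun x => (a x * b x)%:E).
Proof.
move=> ma mb ia ib.
have isq (c : T -> R) : measurable_fun D c ->
    (\int[mu]_(x in D) (c x ^+ 2)%:E < +oo)%E ->
    mu.-integrable D (fun x => (c x ^+ 2)%:E).
  move=> mc ic; apply/integrableP; split.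
    by apply/measurable_EFinP; exact: measurable_funX.
  by under eq_integral do rewrite gee0_abs ?lee_fin ?sqr_ge0//.
apply: (le_integrable mD _ _ (integrableD mD (isq a ma ia) (isq b mb ib))).
  by apply/measurable_EFinP; exact: measurable_funM.
move=> x _; rewrite -EFinD !abse_EFin lee_fin.
rewrite normrM [leRHS]ger0_norm ?addr_ge0 ?sqr_ge0//.
rewrite -(real_normK (num_real (a x))) -(real_normK (num_real (b x))).
have := sqr_ge0 (`|a x| - `|b x|); have := normr_ge0 (a x); have := normr_ge0 (b x).
nra.
Qed.

End weighted_integrals.

(** * Real and imaginary parts of functions in the span *)

Lemma Re_sum {R : rcfType} {I : Type} (r : seq I) (F : I -> R[i]) :
  complex.Re (\sum_(i <- r) F i) = \sum_(i <- r) complex.Re (F i).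
Proof. by apply: (big_morph (@complex.Re R)) => // -[a b] [c e]. Qed.

Lemma Im_sum {R : rcfType} {I : Type} (r : seq I) (F : I -> R[i]) :
  complex.Im (\sum_(i <- r) F i) = \sum_(i <- r) complex.Im (F i).
Proof. by apply: (big_morph (@complex.Im R)) => // -[a b] [c e]. Qed.

Lemma complex_ReM {R : rcfType} (z w : R[i]) :
  complex.Re (z * w) = complex.Re z * complex.Re w - complex.Im z * complex.Im w.
Proof. by case: z w => [a b] [c e]. Qed.

Lemma complex_ImM {R : rcfType} (z w : R[i]) :
  complex.Im (z * w) = complex.Re z * complex.Im w + complex.Im z * complex.Re w.
Proof. by case: z w => [a b] [c e]. Qed.

Lemma sqr_cmod {R : rcfType} (z : R[i]) :
  cmod z ^+ 2 = complex.Re z ^+ 2 + complex.Im z ^+ 2.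
Proof. by case: z => a b; rewrite /= sqr_sqrtr// addr_ge0 ?sqr_ge0. Qed.

Section square_integrable_functions.
Context {d : measure_display} {T : measurableType d} {R : realType}.
Variables (mu : {measure set T -> \bar R}) (D : set T).
Hypothesis mD : measurable D.

Definition real_square_integrable (a : T -> R) : Prop :=
  measurable_fun D a /\ (\int[mu]_(x in D) (a x ^+ 2)%:E < +oo)%E.

Lemma square_integrable_ReIm (u : T -> R[i]) : square_integrable mu D u ->
  real_square_integrable (fun x => complex.Re (u x)) /\
  real_square_integrable (fun x => complex.Im (u x)).
Proof.
move=> [[mRe mIm] iu].
have le_iu (a : T -> R) : measurable_fun D a ->
    (forall x, a x ^+ 2 <= cmod (u x) ^+ 2) -> real_square_integrable a.
  move=> ma au; split => //; apply: le_lt_trans iu; apply: ge0_le_integral => //.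
  - by move=> x _; rewrite lee_fin sqr_ge0.
  - by apply/measurable_EFinP; exact: measurable_funX.
  - apply/measurable_EFinP.
    rewrite (_ : (fun x => _) =
      (fun x => complex.Re (u x) ^+ 2 + complex.Im (u x) ^+ 2)); last first.
      by apply/funext => x; exact: sqr_cmod.
    by apply: measurable_funD; exact: measurable_funX.
  - by move=> x _; rewrite lee_fin.
by split; apply: le_iu => // x; rewrite sqr_cmod ?lerDl ?lerDr sqr_ge0.
Qed.

Lemma integrable_span_mul (N : nat) (phi : 'I_N -> T -> R[i]) (v : T -> R[i])
    (b : T -> R) :
  (forall n, square_integrable mu D (phi n)) -> span_of phi v ->
  real_square_integrable b ->
  mu.-integrable D (fun x => (complex.Re (v x) * b x)%:E) /\
  mu.-integrable D (fun x => (complex.Im (v x) * b x)%:E).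
Proof.
move=> iphi [c ->] [mb ib].
have iRe n : mu.-integrable D (fun x => (complex.Re (phi n x) * b x)%:E).
  by have [[mR iR] _] := square_integrable_ReIm _ (iphi n); exact: integrable_mul.
have iIm n : mu.-integrable D (fun x => (complex.Im (phi n x) * b x)%:E).
  by have [_ [mR iR]] := square_integrable_ReIm _ (iphi n); exact: integrable_mul.
have icomb (s t : 'I_N -> R) : mu.-integrable D (fun x =>
    \sum_n ((s n)%:E * (complex.Re (phi n x) * b x)%:E +
            (t n)%:E * (complex.Im (phi n x) * b x)%:E))%E.
  by apply: integrable_sum => // n _; apply: integrableD => //; exact: integrableZl.
split.
  have := icomb (fun n => complex.Re (c n)) (fun n => - complex.Im (c n)).
  congr (integrable _ _ _); apply/funext => x; rewrite sumEFin; congr EFin.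
  rewrite Re_sum mulr_suml; apply: eq_bigr => n _ /=.
  by rewrite complex_ReM; ring.
have := icomb (fun n => complex.Im (c n)) (fun n => complex.Re (c n)).
congr (integrable _ _ _); apply/funext => x; rewrite sumEFin; congr EFin.
rewrite Im_sum mulr_suml; apply: eq_bigr => n _ /=.
by rewrite complex_ImM; ring.
Qed.

(** The terms that contain Im L vanish almost everywhere; the integrability of
    products with Im L serves to split them off. *)
Lemma inner_real_left (N : nat) (phi : 'I_N -> T -> R[i]) (L u : T -> R[i]) :
  (forall n, square_integrable mu D (phi n)) -> span_of phi L ->
  (\forall x \ae mu, D x -> complex.Im (L x) = 0) -> square_integrable mu D u ->
  inner mu D L u =
    Complex (\int[mu]_(x in D) (complex.Re (L x) * complex.Re (u x)))
            (\int[mu]_(x in D) (complex.Re (L x) * complex.Im (u x))).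
Proof.
move=> iphi VL ImL /square_integrable_ReIm[sRe sIm].
have [iRR iIR] := integrable_span_mul _ _ _ _ iphi VL sRe.
have [iRI iII] := integrable_span_mul _ _ _ _ iphi VL sIm.
rewrite /inner /cintegral.
have Rintegral_add0 (a b a' : T -> R) :
    mu.-integrable D (fun x => (a x)%:E) -> mu.-integrable D (fun x => (b x)%:E) ->
    (forall x, a' x = a x + b x) -> (\forall x \ae mu, D x -> b x = 0) ->
    \int[mu]_(x in D) a' x = \int[mu]_(x in D) a x.
  move=> ia ib a'E b0.
  rewrite (_ : (fun x => _) = (fun x => a x + b x)); last exact/funext.
  rewrite RintegralD// [X in _ + X](_ : _ = 0) ?addr0//.
  rewrite /Rintegral (ae_eq_integral (cst 0%E))//.
  - by rewrite integral0.
  - by case/integrableP : ib.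
  - by apply: filterS b0 => x xb Dx; rewrite /= xb.
congr Complex.
  apply: (Rintegral_add0 _ _ _ iRR iII) => [x|].
    by case: (L x) (u x) => [a b] [c e] /=; rewrite mulNr opprK.
  by apply: filterS ImL => x Lx Dx; rewrite Lx ?mul0r.
apply: (Rintegral_add0 _ (fun x => - complex.Im (L x) * complex.Re (u x)) _ iRI).
- rewrite (_ : (fun x => _) = (fun x => (-1)%:E * (complex.Im (L x) * complex.Re (u x))%:E)%E).
    exact: integrableZl.
  by apply/funext => x; rewrite -EFinM mulN1r mulNr.
- by move=> x; case: (L x) (u x) => [a b] [c e] /=.
- by apply: filterS ImL => x Lx Dx; rewrite Lx ?oppr0 ?mul0r.
Qed.

End square_integrable_functions.

Section real_coordinates.
Context {T : Type} {R : rcfType} {N : nat}.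
Variable phi : 'I_N -> T -> R[i].

Definition real_coords (x : T) : 'rV[R]_(N + N) :=
  row_mx (\row_n complex.Re (phi n x)) (\row_n complex.Im (phi n x)).

Lemma real_coords_lshift x n : real_coords x 0 (lshift N n) = complex.Re (phi n x).
Proof. by rewrite row_mxEl mxE. Qed.

Lemma real_coords_rshift x n : real_coords x 0 (rshift N n) = complex.Im (phi n x).
Proof. by rewrite row_mxEr mxE. Qed.

(** The real and imaginary parts of the equation conj phi(x) = C phi(x). *)
Lemma real_coords_ker (C : 'I_N -> 'I_N -> R[i]) (x : T) :
  (forall n, \sum_m C n m * phi m x = conjc (phi n x)) ->
  real_coords x *m
    block_mx (\matrix_(m, n) complex.Re (C n m) - 1%:M)
             (\matrix_(m, n) complex.Im (C n m))
             (- \matrix_(m, n) complex.Im (C n m))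
             (\matrix_(m, n) complex.Re (C n m) + 1%:M) = 0.
Proof.
move=> Cx; rewrite mul_row_block -[0]row_mx0 mulmxBr mulmxDr !mulmx1 mulmxN.
congr row_mx; apply/rowP => n; rewrite !mxE.
  have /(congr1 (@complex.Re R)) := Cx n.
  rewrite Re_sum (_ : complex.Re (conjc _) = complex.Re (phi n x)); last by case: (phi n x).
  under eq_bigr do rewrite complex_ReM.
  rewrite sumrB => <-; under eq_bigr do rewrite !mxE mulrC.
  under [X in _ - _ - X]eq_bigr do rewrite !mxE mulrC.
  ring.
have /(congr1 (@complex.Im R)) := Cx n.
rewrite Im_sum (_ : complex.Im (conjc _) = - complex.Im (phi n x)); last by case: (phi n x).
under eq_bigr do rewrite complex_ImM.
rewrite big_split/=.
under eq_bigr do rewrite mulrC; under [X in _ + X]eq_bigr do rewrite mulrC.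
move=> E; under eq_bigr do rewrite !mxE; under [X in _ + (X + _)]eq_bigr do rewrite !mxE.
rewrite addrA (addrC (\sum_(_ < _) _)) E addNr//.
Qed.

End real_coordinates.

(** * Reduction to N nodes *)

Lemma conic_combination_le_rank {R : realType} {T : Type} {n : nat}
    (f : T -> 'rV[R]_n) (K : 'M[R]_n) (A : set T) (p : 'rV_n) :
  (forall x, A x -> f x *m K = 0) -> conic_hull f A p ->
  exists M : nat, (M <= \rank (kermx K))%N /\
  exists (x : 'I_M -> T) (w : 'I_M -> R),
    [/\ forall m, A (x m), forall m, 0 < w m & p = \sum_m w m *: f (x m)].
Proof.
move=> fK [M [x [w [xA w_ge0 ->]]]].
have [w' [w'_ge0 <- w'r]] := caratheodory_conic (\matrix_i f (x i)) w_ge0.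
set S := finset _ in w'r; exists #|S|; split.
  apply: leq_trans w'r (mxrankS _); apply/sub_kermxP/row_matrixP => i.
  by rewrite row_mul rowK row0 fK.
exists (x \o enum_val), (fun m => w' 0 (enum_val m)); split => [m|m|].
- exact: xA.
- by have := enum_valP m; rewrite inE lt_neqAle eq_sym w'_ge0 andbT.
- rewrite mulmx_sum_row (bigID (mem S))/= [X in _ + X]big1 ?addr0; last first.
    by move=> i; rewrite inE negbK => /eqP ->; rewrite scale0r.
  by rewrite big_enum_val; apply: eq_bigr => i _; rewrite rowK.
Qed.

Lemma span_of_generator {d : measure_display} {T : measurableType d}
    {R : realType} {N : nat}
    (phi : 'I_N -> T -> R[i]) (n : 'I_N) : span_of phi (phi n).
Proof.
exists (fun m => (m == n)%:R); apply/funext => x.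
rewrite (bigD1 n)//= eqxx mul1r big1 ?addr0// => m /negPf ->.
by rewrite mul0r.
Qed.

Lemma span_of_add {d : measure_display} {T : measurableType d}
    {R : realType} {N : nat} (phi : 'I_N -> T -> R[i])
    (a : R[i]) (u v : T -> R[i]) :
  span_of phi u -> span_of phi v -> span_of phi (fun x => a * u x + v x).
Proof.
move=> [b ->] [c ->]; exists (fun n => a * b n + c n); apply/funext => x.
rewrite mulr_sumr -big_split; apply: eq_bigr => n _ /=.
by rewrite mulrDl mulrA.
Qed.

Lemma linear_on_span {d : measure_display} {T : measurableType d}
    {R : realType} {N : nat} (phi : 'I_N -> T -> R[i])
    (ell : (T -> R[i]) -> R[i]) (c : 'I_N -> R[i]) :
  linear_on (span_of phi) ell ->
  ell (fun x => \sum_n c n * phi n x) = \sum_n c n * ell (phi n).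
Proof.
move=> ell_lin.
have V0 : span_of phi (fun=> 0).
  by exists (fun=> 0); apply/funext => x; rewrite big1// => n _; rewrite mul0r.
have ell0 : ell (fun=> 0) = 0.
  have := ell_lin 1 _ _ V0 V0; rewrite mulr0 addr0 mul1r => /eqP.
  by rewrite eq_sym -subr_eq0 addrK => /eqP.
suff /(_ (index_enum _)) [] : forall r : seq 'I_N,
  span_of phi (fun x => \sum_(n <- r) c n * phi n x) /\
  ell (fun x => \sum_(n <- r) c n * phi n x) = \sum_(n <- r) c n * ell (phi n) by [].
elim=> [|n r [Vr ellr]].
  by rewrite big_nil; under eq_fun do rewrite big_nil.
rewrite big_cons; under eq_fun do rewrite big_cons.
have Vn := span_of_generator phi n.
by split; [exact: span_of_add|rewrite ell_lin// ellr].
Qed.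

(** The nodes can be taken in any set of full measure, in particular among the
    points where conj phi = C phi holds for all the generators at once. *)
Lemma quadrature_on_generators {d : measure_display} {T : measurableType d}
    {R : realType} {N : nat} (mu : {measure set T -> \bar R}) (D : set T)
    (phi : 'I_N -> T -> R[i]) (L : T -> R[i]) :
  measurable D -> (forall n, square_integrable mu D (phi n)) ->
  conj_closed mu D (span_of phi) -> span_of phi L ->
  (\forall x \ae mu, D x -> 0 <= L x) ->
  exists M : nat, (M <= N)%N /\
  exists (x : 'I_M -> T) (w : 'I_M -> R),
    [/\ forall m, D (x m), forall m, 0 < w m &
        forall n, \sum_(m < M) (w m)%:C * phi n (x m) = inner mu D L (phi n)].
Proof.
move=> mD iphi conjV VL L_ge0.
have /choice[C CE] n : exists c : 'I_N -> R[i],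
    \forall x \ae mu, D x -> \sum_m c m * phi m x = conjc (phi n x).
  by have [w [c ->]] := conjV _ (span_of_generator phi n); exists c.
have {}CE : \forall x \ae mu, D x ->
    forall n, \sum_m C n m * phi m x = conjc (phi n x).
  have {CE} : \forall x \ae mu, forall n,
      D x -> \sum_m C n m * phi m x = conjc (phi n x) by exact: filter_forall.
  by apply: filterS => x Cx Dx n; exact: Cx.
pose A := \matrix_(m, n) complex.Re (C n m); pose B := \matrix_(m, n) complex.Im (C n m).
pose K := block_mx (A - 1%:M) B (- B) (A + 1%:M).
pose h x := complex.Re (L x).
have h_ge0 : \forall x \ae mu, D x -> 0 <= h x.
  by apply: filterS L_ge0 => x Lx /Lx; rewrite lecE => /andP[].
have ImL : \forall x \ae mu, D x -> complex.Im (L x) = 0.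
  by apply: filterS L_ge0 => x Lx /Lx; rewrite lecE => /andP[/eqP].
have ihphi j : mu.-integrable D (fun x => (h x * real_coords phi x 0 j)%:E).
  case: (split_ordP j) => n ->; have [sRe sIm] := square_integrable_ReIm _ _ mD _ (iphi n).
    have [+ _] := integrable_span_mul _ _ mD _ _ _ _ iphi VL sRe.
    by congr (integrable _ _ _); apply/funext => x; rewrite real_coords_lshift.
  have [+ _] := integrable_span_mul _ _ mD _ _ _ _ iphi VL sIm.
  by congr (integrable _ _ _); apply/funext => x; rewrite real_coords_rshift.
have phiK : \forall x \ae mu, D x -> real_coords phi x *m K = 0.
  by apply: filterS CE => x Cx /Cx; exact: real_coords_ker.
have := Rintegral_in_conic_hull mu D mD _ _ _ _ h_ge0 ihphi phiK.
move=> /(conic_combination_le_rank _ K)[x [_ //]|M [MK [x [w [xD w_gt0 pE]]]]].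
exists M; split; first exact: leq_trans MK (dim_real_form _ _).
exists x, w; split => // [m|n]; first by have [] := xD m.
rewrite (inner_real_left mu D mD _ phi)//.
have pE' j := congr1 (fun v : 'rV_(N + N) => v 0 j) pE.
apply/eqP; rewrite eq_complex Re_sum Im_sum /=; apply/andP; split; apply/eqP.
  transitivity (\int[mu]_(y in D) (h y * real_coords phi y 0 (lshift N n))).
    have := pE' (lshift N n); rewrite mxE summxE => ->; apply: eq_bigr => m _.
    by rewrite mxE real_coords_lshift complex_ReM/= mul0r subr0.
  by apply: eq_Rintegral => y _; rewrite real_coords_lshift.
transitivity (\int[mu]_(y in D) (h y * real_coords phi y 0 (rshift N n))).
  have := pE' (rshift N n); rewrite mxE summxE => ->; apply: eq_bigr => m _.
  by rewrite mxE real_coords_rshift complex_ImM/= mul0r addr0.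
by apply: eq_Rintegral => y _; rewrite real_coords_rshift.
Qed.

Theorem theorem2p11 (R : realType) (X : completeNormedModType R)
    (G : set (set X)) (openG : forall U : set X, open U -> (<<s G>>) U)
    (mu : {measure set (g_sigma_algebraType G) -> \bar R})
    (D : set (g_sigma_algebraType G)) (suppD : is_closed_support mu D)
    (N : nat) (N_gt0 : (0 < N)%N)
    (phi : 'I_N -> g_sigma_algebraType G -> R[i])
    (phi_on : orthonormal_family mu D phi)
    (tau2 : g_sigma_algebraType G -> R)
    (rho : probability (g_sigma_algebraType G) R)
    (rhoE : sampling_measure mu D phi tau2 rho)
    (ell : (g_sigma_algebraType G -> R[i]) -> R[i])
    (ell_lin : linear_on (span_of phi) ell)
    (ell_neq0 : exists2 v, span_of phi v & ell v != 0)
    (L : g_sigma_algebraType G -> R[i])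
    (L_riesz : riesz_representer mu D (span_of phi) ell L)
    (adm : relatively_admissible mu D phi tau2 rho ell L)
    (nonneg : nonnegative_pair mu D (span_of phi) ell L) :
  exists M : nat, (M <= N)%N /\
  exists (x : 'I_M -> g_sigma_algebraType G) (w : 'I_M -> R),
    [/\ forall m, D (x m),
        forall m, 0 < w m &
        forall v, span_of phi v ->
          \sum_(m < M) (w m)%:C * v (x m) = ell v].
Proof.
have [closedD _ _] := suppD.
have mD : measurable D.
  rewrite -(setCK D); apply: measurableC.
  by apply: (openG (~` D)); exact: closed_openC.
have [iphi _] := phi_on.
have [VL ellE] := L_riesz.
have [conjV _ [L' [_ L'L L'_ge0]]] := nonneg.
have L_ge0 : \forall x \ae mu, D x -> 0 <= L x.
  by apply: filterS L'L => x L'Lx Dx; rewrite -L'Lx// L'_ge0.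
have [M [MN [x [w [xD w_gt0 quad]]]]] :=
  quadrature_on_generators _ _ _ _ mD iphi conjV VL L_ge0.
exists M; split => //; exists x, w; split => // _ [c ->].
rewrite linear_on_span//.
under eq_bigr do rewrite mulr_sumr.
rewrite exchange_big; apply: eq_bigr => n _ /=.
rewrite ellE; last exact: span_of_generator.
rewrite -quad mulr_sumr; apply: eq_bigr => m _; exact: mulrCA.
Qed.
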